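(* Let $\mathcal{A},\mathcal{B}\in\mathbb{R}^{n\times n\times p}$ be positive semidefinite (PSD) Hermitian tensors. Then $$\sum_{i=1}^{n}\lambda_i(\mathcal{A})\,\lambda_{n-i+1}(\mathcal{B})\;\le\;\operatorname{tr}(\mathcal{A}*\mathcal{B})\;\le\;\sum_{i=1}^{n}\lambda_i(\mathcal{A})\,\lambda_i(\mathcal{B}),$$ where $\lambda_i(\mathcal{A})$ and $\lambda_i(\mathcal{B})$ denote the eigenvalues (T-eigenvalues) of $\mathcal{A}$ and $\mathcal{B}$, respectively, arranged in non-increasing order.
   Context: For a third-order tensor $\mathcal{A}$ of size $m\times n\times p$, its frontal slices are $A^{(k)}=\mathcal{A}(:,:,k)$, $k=1,\dots,p$. The block circulant matrix $\operatorname{bcirc}(\mathcal{A})$ is the $mp\times np$ matrix whose $(i,j)$ block ($1\le i,j\le p$) is $A^{(((i-j)\bmod p)+1)}$. $\operatorname{unfold}(\mathcal{A})$ is the $mp\times n$ matrix obtained by stacking $A^{(1)},\dots,A^{(p)}$ vertically, and $\operatorname{fold}$ is its inverse. The T-product of $\mathcal{A}$ (size $m\times n\times p$) and $\mathcal{B}$ (size $n\times s\times p$) is $\mathcal{A}*\mathcal{B}=\operatorname{fold}(\operatorname{bcirc}(\mathcal{A})\operatorname{unfold}(\mathcal{B}))$, of size $m\times s\times p$. The conjugate transpose $\mathcal{A}^*$ is obtained by conjugate-transposing each frontal slice and reversing the order of slices $2,\dots,p$; $\mathcal{A}$ is Hermitian if $\mathcal{A}=\mathcal{A}^*$. A number $\lambda$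 is a T-eigenvalue of $\mathcal{A}\in\mathbb{R}^{n\times n\times p}$ if $\mathcal{A}*\mathcal{X}=\lambda\mathcal{X}$ for some nonzero $\mathcal{X}$ of size $n\times 1\times p$; the T-eigenvalues of $\mathcal{A}$ are the eigenvalues of $\operatorname{bcirc}(\mathcal{A})$, and they are all real when $\mathcal{A}$ is Hermitian. A Hermitian tensor $\mathcal{A}$ is positive semidefinite if $\langle\mathcal{X},\mathcal{A}*\mathcal{X}\rangle\ge 0$ for all $\mathcal{X}\in\mathbb{C}^{n\times1\times p}$, i.e. if $\operatorname{bcirc}(\mathcal{A})$ is positive semidefinite. The trace of a T-product is $\operatorname{tr}(\mathcal{A}*\mathcal{B})=\sum_{k=1}^p\operatorname{tr}(\widehat{\mathcal{A}}^{(k)}\widehat{\mathcal{B}}^{(k)})$, where $\widehat{\mathcal{A}}^{(k)}$ is the $k$-th frontal slice of the (unnormalized) discrete Fourier transform $\widehat{\mathcal{A}}$ of $\mathcal{A}$ along the third mode, and similarly for $\mathcal{B}$.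
   Formalization: The sums run over all np T-eigenvalues (i from 1 to np, with λ_{np−i+1}(B) in the lower bound) rather than only n; with n the claim fails for p ≥ 2, e.g. for A = B = identity tensor the trace is np but the upper bound is n. *)

(* Defs.v *)
From HB Require Import structures.
From mathcomp Require Import all_boot all_order all_algebra.
From mathcomp Require Import reals trigo.
From mathcomp Require Import complex.

Set Implicit Arguments.
Unset Strict Implicit.
Unset Printing Implicit Defensive.

Import Order.TTheory GRing.Theory Num.Theory.
Local Open Scope ring_scope.
Local Open Scope complex_scope.

(* An m x n x p tensor is the family of its p frontal slices; slice k+1 of the
   1-based convention is [A k] with k : 'I_p. *)
Notation tensor K m n p := {ffun 'I_p -> 'M[K]_(m, n)}.

Section TProduct.
Variables (K : pzRingType) (p : nat).

(* [i - j] is taken in the additive group 'I_p.+1, i.e. modulo p.+1. *)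
Definition bcirc m n (A : tensor K m n p.+1) :
    'M[K]_(\sum_(i < p.+1) m, \sum_(j < p.+1) n) :=
  \mxblock_(i < p.+1, j < p.+1) A (i - j).

Definition unfold m n (A : tensor K m n p.+1) : 'M[K]_(\sum_(i < p.+1) m, n) :=
  \mxcol_(i < p.+1) A i.

Definition fold m n (M : 'M[K]_(\sum_(i < p.+1) m, n)) : tensor K m n p.+1 :=
  [ffun i => submxcol M i].

Definition tprod m n s (A : tensor K m n p.+1) (B : tensor K n s p.+1) :
    tensor K m s p.+1 :=
  fold (bcirc A *m unfold B).

Lemma unfoldK m n : cancel (@unfold m n) (@fold m n).
Proof. by move=> A; apply/ffunP => i; rewrite ffunE mxcolK. Qed.

Lemma foldK m n : cancel (@fold m n) (@unfold m n).
Proof.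
by move=> M; apply/mxcolP => i; rewrite mxcolK ffunE.
Qed.

Lemma tprodE m n s (A : tensor K m n p.+1) (B : tensor K n s p.+1) i :
  tprod A B i = \sum_j A (i - j) *m B j.
Proof. by rewrite ffunE mul_mxblock_mxrow mxcolK. Qed.

End TProduct.

Section ComplexTensors.
Variables (R : realType) (p : nat).
Local Notation C := R[i].

Definition tcomplex m n (A : tensor R m n p.+1) : tensor C m n p.+1 :=
  [ffun k => map_mx (real_complex R) (A k)].

(* With 0-based slices, k |-> - k modulo p.+1 fixes the first slice and
   reverses the order of the others. *)
Definition tctrans m n (A : tensor C m n p.+1) : tensor C n m p.+1 :=
  [ffun k => map_mx Num.conj (A (- k))^T].

Definition thermitian n (A : tensor C n n p.+1) : Prop := tctrans A = A.

Definition tdot m n (X Y : tensor C m n p.+1) : C :=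
  \sum_k \sum_i \sum_j Num.conj (X k i j) * Y k i j.

(* In the order of R[i], [0 <= z] says that z is real and nonnegative. *)
Definition tpsd n (A : tensor C n n p.+1) : Prop :=
  thermitian A /\ forall X : tensor C n 1 p.+1, 0 <= tdot X (tprod A X).

Definition is_T_eigenvalue n (A : tensor C n n p.+1) (l : C) : Prop :=
  exists2 X : tensor C n 1 p.+1, X != 0 & tprod A X = l *: X.

(* The n * p.+1 eigenvalues of [bcirc A], with algebraic multiplicity, in
   non-increasing order. The order of R[i] is total only on the reals, so the
   sorting is meaningful when all the eigenvalues are real, in particular when A
   is Hermitian. *)
Definition T_eigenvalues n (A : tensor C n n p.+1) : seq C :=
  sort (fun x y : C => y <= x)
    (sval (closed_field_poly_normal (char_poly (bcirc A)))).

(* 1-based: [T_lambda A 1] is the largest T-eigenvalue. *)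
Definition T_lambda n (A : tensor C n n p.+1) (i : nat) : C :=
  nth 0 (T_eigenvalues A) i.-1.

(* exp (- 2 pi i / p.+1) *)
Definition dft_root : C :=
  cos (2 * pi / p.+1%:R) +i* - sin (2 * pi / p.+1%:R).

Definition tdft m n (A : tensor C m n p.+1) : tensor C m n p.+1 :=
  [ffun k : 'I_p.+1 => \sum_(j < p.+1) dft_root ^+ (k * j) *: A j].

(* The trace of the T-product of A and B. *)
Definition trace_tprod n (A B : tensor C n n p.+1) : C :=
  \sum_k \tr (tdft A k *m tdft B k).

Lemma T_eigenvalues_char_poly n (A : tensor C n n p.+1) :
  char_poly (bcirc A) = \prod_(l <- T_eigenvalues A) ('X - l%:P).
Proof.
rewrite /T_eigenvalues; case: closed_field_poly_normal => s /= def_s.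
rewrite {1}def_s (monicP (char_poly_monic _)) scale1r.
by apply: perm_big; rewrite perm_sym perm_sort.
Qed.

Lemma size_T_eigenvalues n (A : tensor C n n p.+1) :
  size (T_eigenvalues A) = (n * p.+1)%N.
Proof.
have := congr1 (fun q : {poly C} => size q) (T_eigenvalues_char_poly A).
rewrite /= size_char_poly size_prod_XsubC => -[<-].
by rewrite sum_nat_const card_ord mulnC.
Qed.

Lemma mem_T_eigenvalues n (A : tensor C n n p.+1) l :
  reflect (is_T_eigenvalue A l) (l \in T_eigenvalues A).
Proof.
have char_tr : char_poly (bcirc A)^T = char_poly (bcirc A).
  rewrite /char_poly -det_tr /char_poly_mx; congr (\det _).
  by rewrite linearB /= tr_scalar_mx -map_trmx trmxK.
apply: (iffP idP) => [|[X nzX eqX]].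
  rewrite -root_prod_XsubC -T_eigenvalues_char_poly -char_tr.
  rewrite -eigenvalue_root_char => /eigenvalueP[v eqv nzv].
  exists (fold v^T).
    apply: contraNneq nzv => v0; rewrite -[v]trmxK -[v^T]foldK v0.
    by apply/eqP/matrixP => a b; rewrite !(mxE, ffunE).
  rewrite /tprod (foldK v^T) -[bcirc A]trmxK -trmx_mul eqv linearZ /=.
  by apply/ffunP => i; rewrite !ffunE; apply/matrixP => a b; rewrite !mxE.
rewrite -root_prod_XsubC -T_eigenvalues_char_poly -char_tr.
rewrite -eigenvalue_root_char; apply/eigenvalueP; exists (unfold X)^T.
  rewrite -trmx_mul -linearZ /=; congr trmx.
  rewrite -[LHS]foldK -/(tprod A X) eqX -[RHS]foldK; congr unfold.
  rewrite -{1}(unfoldK X); apply/ffunP => i; apply/matrixP => a b.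
  by rewrite !(mxE, ffunE).
apply: contraNneq nzX => X0; rewrite -(unfoldK X) -[unfold X]trmxK X0.
by apply/eqP/ffunP => i; rewrite !ffunE trmx0 submxcol0.
Qed.

Lemma tdot_gt0 m n (X : tensor C m n p.+1) : X != 0 -> 0 < tdot X X.
Proof.
have ge0 k i j : 0 <= Num.conj (X k i j) * X k i j by rewrite mulrC mul_conjC_ge0.
have dot_ge0 : 0 <= tdot X X.
  by apply: sumr_ge0 => k _; apply: sumr_ge0 => i _; apply: sumr_ge0.
move=> nzX; rewrite lt_def dot_ge0 andbT; apply: contraNneq nzX => X0.
apply/eqP/ffunP => k; apply/matrixP => i j; rewrite !(mxE, ffunE).
have/eqP := X0; rewrite psumr_eq0 => [/allP/(_ k (mem_index_enum _))/=|k' _].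
  rewrite psumr_eq0 => [/allP/(_ i (mem_index_enum _))/=|i' _].
    rewrite psumr_eq0 => [/allP/(_ j (mem_index_enum _))/=|j' _]; last exact: ge0.
    by rewrite mulrC mul_conjC_eq0 => /eqP.
  by apply: sumr_ge0.
by apply: sumr_ge0 => i' _; apply: sumr_ge0.
Qed.

Lemma T_eigenvalues_ge0 n (A : tensor C n n p.+1) l :
  tpsd A -> l \in T_eigenvalues A -> 0 <= l.
Proof.
move=> [_ psdA] /mem_T_eigenvalues[X /tdot_gt0 X_gt0 eqX].
have := psdA X; rewrite eqX; suff ->: tdot X (l *: X) = l * tdot X X.
  by rewrite pmulr_lge0.
rewrite /tdot mulr_sumr; apply: eq_bigr => k _; rewrite mulr_sumr.
apply: eq_bigr => i _; rewrite mulr_sumr; apply: eq_bigr => j _.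
by rewrite !(mxE, ffunE) mulrCA.
Qed.

Lemma T_eigenvalues_sorted n (A : tensor C n n p.+1) :
  tpsd A -> sorted (fun x y : C => y <= x) (T_eigenvalues A).
Proof.
move=> psdA; apply: (sort_sorted_in (P := [pred l : C | 0 <= l])).
  move=> x y /ger0_real xR /ger0_real yR; rewrite orbC; exact: real_leVge.
apply/allP => l l_s; apply: (T_eigenvalues_ge0 psdA).
by rewrite mem_sort.
Qed.

End ComplexTensors.

(* Main.v *)
Require Import Defs.
From mathcomp Require Import all_boot all_order all_algebra.
From mathcomp Require Import fingroup perm sesquilinear spectral lra.
From mathcomp Require Import reals trigo.
From mathcomp Require Import complex.

(* Orthogonality of the characters of Z/p turns the trace of the T-product into
   tr (bcirc A *m bcirc B). Both block circulant matrices are Hermitian; after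
   unitary diagonalization this trace is the sum of a_i b_j |W_ij|^2, where a and
   b are the sorted eigenvalues and W is unitary. The matrix of the |W_ij|^2 is
   doubly stochastic, and two Abel summations (one in a, one in b) bound the sum
   by its value at the identity matrix. The lower bound is the upper bound
   applied to a and to the reversal of - b. *)

Set Implicit Arguments.
Unset Strict Implicit.
Unset Printing Implicit Defensive.

Import Order.TTheory GRing.Theory Num.Theory.
Local Open Scope ring_scope.

(** * Abel summation and doubly stochastic weights *)

Section Majorization.
Variable F : numDomainType.

(** Abel summation by induction: with the last term split off, the rest is at least [a N] times a
    partial sum of [d]; as that sum is nonnegative, [a N] may be lowered to [a N.+1]. *)
Lemma sum_mul_nonincreasing_ge N (a : nat -> F) (d : 'I_N.+1 -> F) :
    (forall i, (i < N)%N -> a i.+1 <= a i) ->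
    (forall k, (k <= N)%N -> 0 <= \sum_(i < N.+1 | (i < k)%N) d i) ->
  a N * \sum_i d i <= \sum_(i < N.+1) a i * d i.
Proof.
elim: N d => [|N IHN] d a_dec d_ge0; first by rewrite !big_ord1.
rewrite !(big_ord_recr N.+1) /= mulrDr lerD2r.
have dE k : (k <= N.+1)%N -> \sum_(i < N.+2 | (i < k)%N) d i =
    \sum_(i < N.+1 | (i < k)%N) d (widen_ord (leqnSn _) i).
  move=> k_le; rewrite big_mkcond big_ord_recr /= ltnNge k_le addr0.
  by rewrite -big_mkcond.
have le_IH := IHN (fun i => d (widen_ord (leqnSn _) i))
  (fun i lt_iN => a_dec i (ltnW lt_iN)).
apply: le_trans (le_IH _) => [|k k_le]; last first.
  by rewrite -dE ?d_ge0// ltnW.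
rewrite ler_wpM2r ?a_dec //.
have := d_ge0 _ (leqnn _); rewrite dE // => d_ge0N.
by rewrite (eq_bigl (fun i : 'I_N.+1 => (i < N.+1)%N)) // => i; rewrite ltn_ord.
Qed.

(** Abel summation for [y - x], whose total is 0. *)
Lemma ler_sum_nonincreasing N (a : nat -> F) (x y : 'I_N -> F) :
    (forall i, (i.+1 < N)%N -> a i.+1 <= a i) ->
    (forall k, \sum_(i < N | (i < k)%N) x i <= \sum_(i < N | (i < k)%N) y i) ->
    \sum_i x i = \sum_i y i ->
  \sum_(i < N) a i * x i <= \sum_(i < N) a i * y i.
Proof.
case: N x y => [|N] x y a_dec le_xy eq_xy; first by rewrite !big_ord0.
rewrite -subr_ge0 -sumrB; under eq_bigr do rewrite -mulrBr.
apply: le_trans (@sum_mul_nonincreasing_ge N a (fun i => y i - x i) _ _) => //.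
  by rewrite sumrB eq_xy subrr mulr0.
by move=> k _; rewrite sumrB subr_ge0.
Qed.

Definition doubly_stochastic N (S : 'M[F]_N) :=
  [/\ forall i j, 0 <= S i j, forall i, \sum_j S i j = 1
    & forall j, \sum_i S i j = 1].

Lemma doubly_stochastic_le N (S : 'M[F]_N) (a b : nat -> F) :
    doubly_stochastic S ->
    (forall i, (i.+1 < N)%N -> a i.+1 <= a i) ->
    (forall i, (i.+1 < N)%N -> b i.+1 <= b i) ->
  \sum_(i < N) \sum_(j < N) a i * b j * S i j <= \sum_(i < N) a i * b i.
Proof.
move=> [S_ge0 row1 col1] a_dec b_dec.
under eq_bigr do (under eq_bigr do rewrite -mulrA).
under eq_bigr do rewrite -mulr_sumr.
(* Summation in [a]: the weighted row sums of [b] are compared with [b] itself. *)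
apply: ler_sum_nonincreasing => // [k|]; last first.
  rewrite exchange_big; apply: eq_bigr => j _.
  by rewrite -mulr_sumr col1 mulr1.
rewrite exchange_big /=; under eq_bigr do rewrite -mulr_sumr.
have mkcondE (P : pred 'I_N) (x : 'I_N -> F) :
    \sum_(i | P i) x i = \sum_i x i * (P i)%:R.
  rewrite big_mkcond; apply: eq_bigr => i _.
  by case: (P i); rewrite ?mulr1 ?mulr0.
(* Summation in [b]: the column masses of the first [k] rows are compared with the indicator of the
   indices below [k]. *)
rewrite [leRHS]mkcondE; apply: ler_sum_nonincreasing => // [l|].
  (* The corner of [k] rows and [l] columns has mass at most [minn k l]: by column sums if [l <= k],
     by row sums otherwise. *)
  case: (leqP l k) => [l_le_k | /ltnW k_le_l].
    apply: ler_sum => j /leq_trans/(_ l_le_k) ->; rewrite -(col1 j).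
    by rewrite [leRHS](bigID (fun i : 'I_N => (i < k)%N)) /= lerDl sumr_ge0.
  rewrite exchange_big /=.
  rewrite [leRHS](_ : _ = \sum_(i < N | (i < k)%N) 1); last first.
    rewrite [LHS]big_mkcond [RHS]big_mkcond; apply: eq_bigr => i _.
    by case: (ltnP i k) => [/leq_trans/(_ k_le_l) ->|]; last case: ifP.
  apply: ler_sum => i _; rewrite -(row1 i).
  by rewrite [leRHS](bigID (fun i : 'I_N => (i < l)%N)) /= lerDl sumr_ge0.
rewrite exchange_big /=; under eq_bigr do rewrite row1.
by rewrite mkcondE; apply: eq_bigr => i _; rewrite mul1r.
Qed.

Lemma doubly_stochastic_ge N (S : 'M[F]_N) (a b : nat -> F) :
    doubly_stochastic S ->
    (forall i, (i.+1 < N)%N -> a i.+1 <= a i) ->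
    (forall i, (i.+1 < N)%N -> b i.+1 <= b i) ->
  \sum_(i < N) a i * b (N - i.+1)%N
    <= \sum_(i < N) \sum_(j < N) a i * b j * S i j.
Proof.
move=> [S_ge0 row1 col1] a_dec b_dec; rewrite -lerN2 -!sumrN.
(* Negation and reversal each flip the order, so [b'] is again nonincreasing below [N]; reversing
   the columns of [S] to match keeps it doubly stochastic. *)
pose b' i := - b (N - i.+1)%N; pose S' := \matrix_(i, j) S i (rev_ord j).
have: doubly_stochastic S'.
  split=> [i j|i|j]; first by rewrite mxE.
    rewrite -(row1 i) [RHS](reindex_inj rev_ord_inj) /=.
    by apply: eq_bigr => j _; rewrite mxE.
  by rewrite -(col1 (rev_ord j)); apply: eq_bigr => i _; rewrite mxE.
move/(@doubly_stochastic_le N S' a b')/(_ a_dec) => le_S'.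
under [leRHS]eq_bigr do rewrite -mulrN.
apply: (le_trans _ (le_S' _)) => [|i i_lt]; last first.
  have := b_dec (N - i.+2)%N; rewrite /b' lerN2.
  rewrite (_ : (N - i.+2).+1 = (N - i.+1)%N) ?(subnSK i_lt) //; apply.
  by rewrite ltn_subrL /= (ltn_trans _ i_lt).
rewrite le_eqVlt; apply/orP; left; apply/eqP.
apply: eq_bigr => i _; rewrite -sumrN (reindex_inj rev_ord_inj).
by apply: eq_bigr => j _; rewrite mxE -mulNr -mulrN.
Qed.

End Majorization.

(** * Unitary diagonalization and bounds for the trace of a product *)

Section NormalMatrices.
Variables (C : numClosedFieldType) (N : nat).
Local Open Scope sesquilinear_scope.

Lemma char_poly_conj (P M : 'M[C]_N) :
  P \in unitmx -> char_poly (invmx P *m M *m P) = char_poly M.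
Proof.
move=> P_unit; pose Q := map_mx (@polyC C) P.
have QVQ : map_mx polyC (invmx P) *m Q = 1%:M.
  by rewrite -map_mxM mulVmx // map_mx1.
rewrite /char_poly; have ->: char_poly_mx (invmx P *m M *m P) =
    map_mx polyC (invmx P) *m char_poly_mx M *m Q.
  rewrite /char_poly_mx mulmxBr mulmxBl !map_mxM /=; congr (_ - _).
  by rewrite scalar_mxC -mulmxA QVQ mulmx1.
by rewrite !det_mulmx mulrAC -det_mulmx QVQ det1 mul1r.
Qed.

(** The spectral theorem gives the eigenvalues in an uncontrolled order. By unique factorization of
    the characteristic polynomial they are a permutation of [s], and permuting the rows of the
    unitary matrix restores the order of [s]. *)
Lemma normalmx_diag_eigenvalues (M : 'M[C]_N) (s : seq C) :
    M \is normalmx -> char_poly M = \prod_(l <- s) ('X - l%:P) ->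
  exists2 P : 'M[C]_N, P \is unitarymx
    & M = P^t* *m diag_mx (\row_k s`_k) *m P.
Proof.
move=> /orthomx_spectralP; set P := spectralmx M; set d := spectral_diag M.
have P_unitary : P \is unitarymx by exact: spectral_unitarymx.
move=> defM char_s.
have: perm_eq s [tuple d 0 i | i < N].
  apply: prod_XsubC_eq; rewrite -char_s defM char_poly_conj ?unitarymx_unit //.
  rewrite char_poly_trig ?diag_mx_is_trig //.
  rewrite big_map big_enum; apply: eq_bigr => i _ /=.
  by rewrite mxE eqxx mulr1n.
case/tuple_permP=> sigma def_s.
have s_i (i : 'I_N) : s`_i = d 0 (sigma i).
  by rewrite def_s -tnth_nth !tnth_mktuple.
exists (row_perm sigma P).
  rewrite row_permE mul_unitarymx //; apply/unitarymxP.
  by rewrite tr_perm_mx map_perm_mx -perm_mxM mulgV perm_mx1.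
rewrite {1}defM invmx_unitary //.
apply/matrixP => i j; rewrite mul_mx_diag mul_mx_diag !mxE.
rewrite (reindex_inj (@perm_inj _ sigma)); apply: eq_bigr => k _.
by rewrite !mxE s_i.
Qed.

(** Rows of a unitary matrix are unit vectors; its transpose is unitary too, which gives the
    columns. *)
Lemma unitarymx_doubly_stochastic (W : 'M[C]_N) :
  W \is unitarymx -> doubly_stochastic (\matrix_(i, j) `|W i j| ^+ 2).
Proof.
have row1 (V : 'M[C]_N) i : V \is unitarymx -> \sum_j `|V i j| ^+ 2 = 1.
  move=> /unitarymxP/matrixP/(_ i i); rewrite !mxE eqxx mulr1n => <-.
  by apply: eq_bigr => j _; rewrite normCK !mxE.
move=> W_unitary; split=> [i j|i|j]; first by rewrite mxE exprn_ge0.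
  by rewrite -(row1 W i) //; apply: eq_bigr => j _; rewrite mxE.
rewrite -(row1 W^T j) ?trmx_unitary //.
by apply: eq_bigr => i _; rewrite !mxE.
Qed.

Lemma mxtrace_mul_eigenvalue_bounds (A B : 'M[C]_N) (s t : seq C) :
    A \is normalmx -> B \is normalmx ->
    char_poly A = \prod_(l <- s) ('X - l%:P) ->
    char_poly B = \prod_(l <- t) ('X - l%:P) ->
    (forall i, (i.+1 < N)%N -> s`_i.+1 <= s`_i) ->
    (forall i, (i.+1 < N)%N -> t`_i.+1 <= t`_i) ->
  \sum_(i < N) s`_i * t`_(N - i.+1) <= \tr (A *m B) <= \sum_(i < N) s`_i * t`_i.
Proof.
move=> A_normal B_normal char_A char_B s_dec t_dec.
have [P P_unitary ->] := normalmx_diag_eigenvalues A_normal char_A.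
have [Q Q_unitary ->] := normalmx_diag_eigenvalues B_normal char_B.
(* Change of basis between the two eigenbases; cyclicity of the trace makes only [W] appear. *)
pose W := P *m Q^t*.
have W_unitary : W \is unitarymx by rewrite mul_unitarymx // trmxC_unitary.
have -> : \tr (P^t* *m diag_mx (\row_k s`_k) *m P
               *m (Q^t* *m diag_mx (\row_k t`_k) *m Q)) =
    \tr (diag_mx (\row_k s`_k) *m W *m diag_mx (\row_k t`_k) *m W^t*).
  rewrite /W trmx_mul map_mxM trmxCK -!mulmxA mxtrace_mulC !mulmxA.
  by rewrite -!mulmxA.
have -> : \tr (diag_mx (\row_k s`_k) *m W *m diag_mx (\row_k t`_k) *m W^t*) =
    \sum_(i < N) \sum_(j < N) s`_i * t`_j * (\matrix_(i, j) `|W i j| ^+ 2) i j.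
  apply: eq_bigr => i _; rewrite mxE; apply: eq_bigr => j _.
  rewrite mul_mx_diag mul_diag_mx !mxE normCK -!mulrA; congr (_ * _).
  by rewrite mulrCA.
have W_ds := unitarymx_doubly_stochastic W_unitary.
(* The majorization bounds hold in the partial order of [C], so no passage to real numbers is
   needed. *)
by rewrite doubly_stochastic_ge // doubly_stochastic_le.
Qed.

End NormalMatrices.

(** * Fourier transform and block circulant matrices *)

Section TraceDFT.
Variables (R : realType) (p : nat).
Local Open Scope complex_scope.
Local Notation C := R[i].
Local Notation omega := (dft_root R p).

(** De Moivre's formula. *)
Lemma dft_rootX k :
  omega ^+ k = cos (2 * pi / p.+1%:R *+ k) +i* - sin (2 * pi / p.+1%:R *+ k).
Proof.
elim: k => [|k IHk]; first by rewrite expr0 !mulr0n cos0 sin0 oppr0.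
rewrite exprSr IHk /dft_root; set x := _ / _; rewrite mulrSr cosD sinD.
by simpc; congr (_ +i* _); rewrite addrC.
Qed.

Lemma dft_root_primitive : p.+1.-primitive_root omega.
Proof.
apply/andP; split=> //; apply/forallP => i; rewrite unity_rootE.
have xE : 2 * pi / p.+1%:R *+ i.+1 = pi * (i.+1%:R / p.+1%:R) *+ 2 :> R.
  rewrite -mulr_natr -[RHS]mulr_natr.
  by rewrite !mulrA mulrAC [_ * 2]mulrC !mulrA mulrAC.
apply/eqP; case: (eqVneq i.+1 p.+1) => [ip|ip].
  apply/eqP; rewrite dft_rootX xE ip divff ?pnatr_eq0 // mulr1 cos2pi sin2pi.
  by rewrite oppr0.
(* For [i.+1 < p.+1] the half-angle [z] lies strictly between 0 and [pi], so the real part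
   [cos (2 z) = 1 - 2 sin^2 z] of the power is less than 1. *)
pose z : R := pi * (i.+1%:R / p.+1%:R); have : 0 < sin z ^+ 2.
  rewrite exprn_gt0 // sin_gt0_pi // mulr_gt0 ?pi_gt0 ?divr_gt0 //=.
  rewrite -[ltRHS]mulr1 ltr_pM2l ?pi_gt0 // ltr_pdivrMr ?ltr0n // mul1r ltr_nat.
  by rewrite ltn_neqAle ip ltn_ord.
apply: contraTF => /eqP; rewrite -/z in xE *.
rewrite dft_rootX xE => /(congr1 (@complex.Re _)) /=.
by rewrite cos_mulr2n; have := cos2Dsin2 z; lra.
Qed.

(** Orthogonality of characters, without conjugation, hence [- i]: a geometric sum whose ratio is a
    root of unity of order dividing [p.+1]. *)
Lemma sum_dft_root (i j : 'I_p.+1) :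
  \sum_(k < p.+1) omega ^+ (k * i) * omega ^+ (k * j) = p.+1%:R * (j == - i)%:R.
Proof.
under eq_bigr => k _ do rewrite -exprD -mulnDr mulnC exprM.
have rootX : (omega ^+ (i + j)) ^+ p.+1 = 1.
  by rewrite exprAC (prim_expr_order dft_root_primitive) expr1n.
have -> : (j == - i) = (omega ^+ (i + j) == 1).
  rewrite -(prim_order_dvd dft_root_primitive).
  by rewrite -addr_eq0 [j + i]addrC -val_eqE.
case: eqVneq => [->|ne1].
  by under eq_bigr do rewrite expr1n; rewrite sumr_const card_ord mulr1.
apply: (mulfI (x := omega ^+ (i + j) - 1)); first by rewrite subr_eq0.
by rewrite -subrX1 rootX subrr !mulr0.
Qed.

Lemma trace_tprod_bcirc n (A B : tensor C n n p.+1) :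
  trace_tprod A B = \tr (bcirc A *m bcirc B).
Proof.
(* Both traces equal this expression: the Fourier side by orthogonality, the block side by shift
   invariance. *)
transitivity (p.+1%:R * \sum_(i < p.+1) \tr (A i *m B (- i))).
  rewrite /trace_tprod.
  have E k : \tr (tdft A k *m tdft B k) = \sum_(i < p.+1) \sum_(j < p.+1)
      omega ^+ (k * i) * omega ^+ (k * j) * \tr (A i *m B j).
    rewrite !ffunE mulmx_suml raddf_sum; apply: eq_bigr => i _.
    rewrite mulmx_sumr raddf_sum; apply: eq_bigr => j _ /=.
    by rewrite -scalemxAl -scalemxAr scalerA mxtraceZ.
  under eq_bigr => k _ do rewrite E; rewrite exchange_big mulr_sumr.
  apply: eq_bigr => i _; rewrite exchange_big /=.
  under eq_bigr do rewrite -mulr_suml sum_dft_root.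
  rewrite (bigD1 (- i)) // eqxx mulr1 big1 => [|j /negbTE ne_j].
    exact: addr0.
  by rewrite ne_j mulr0 mul0r.
rewrite /bcirc mul_mxblock mxtrace_mxblock.
transitivity (\sum_(j < p.+1) \sum_(i < p.+1) \tr (A i *m B (- i))).
  by rewrite sumr_const card_ord mulr_natl.
under [RHS]eq_bigr do rewrite raddf_sum /=.
rewrite [RHS]exchange_big /=; apply: eq_bigr => j _.
(* Shifting the diagonal block index by [j] makes the inner sum independent of [j]. *)
rewrite [RHS](reindex_inj (addrI j)); apply: eq_bigr => i _.
by rewrite [j + i]addrC addrK opprD [- i - j]addrC addrA subrr add0r.
Qed.

(** Transposing blocks turns [i - j] into [j - i], which the slice reversal in [tctrans] undoes; so
    [bcirc A] is Hermitian. *)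
Lemma bcirc_normal n (A : tensor C n n p.+1) :
  thermitian A -> bcirc A \is normalmx.
Proof.
move=> hermA; suff bcircH : map_mx Num.conj (bcirc A)^T = bcirc A.
  by apply/normalmxP; rewrite bcircH.
rewrite tr_mxblock; apply/matrixP => i j.
by rewrite !mxE -[in RHS]hermA ffunE !mxE opprB.
Qed.

End TraceDFT.

(** The sums run over all [n * p.+1] T-eigenvalues, the full spectra of the block circulant
    matrices. *)
Theorem theorem3p4 (R : realType) (n p : nat) (A B : tensor R n n p.+1)
    (psdA : tpsd (tcomplex A)) (psdB : tpsd (tcomplex B)) :
  let N := (n * p.+1)%N in
  \sum_(1 <= i < N.+1)
      T_lambda (tcomplex A) i * T_lambda (tcomplex B) (N - i + 1)
    <= trace_tprod (tcomplex A) (tcomplex B) /\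
  trace_tprod (tcomplex A) (tcomplex B)
    <= \sum_(1 <= i < N.+1) T_lambda (tcomplex A) i * T_lambda (tcomplex B) i.
Proof.
move=> N; set A' := tcomplex A; set B' := tcomplex B.
have dimE : (\sum_(i < p.+1) n)%N = N by rewrite sum_nat_const card_ord mulnC.
have eig_dec (M : tensor R[i] n n p.+1) i : tpsd M ->
    (i.+1 < \sum_(i < p.+1) n)%N ->
    (T_eigenvalues M)`_i.+1 <= (T_eigenvalues M)`_i.
  move=> psdM; rewrite dimE /N -(size_T_eigenvalues M) => lt_i.
  by have /(sortedP 0)/(_ i lt_i) := T_eigenvalues_sorted psdM.
have := mxtrace_mul_eigenvalue_bounds (bcirc_normal psdA.1)
  (bcirc_normal psdB.1) (T_eigenvalues_char_poly A') (T_eigenvalues_char_poly B')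
  (fun i => eig_dec _ i psdA) (fun i => eig_dec _ i psdB).
rewrite -trace_tprod_bcirc dimE !big_add1 /= !big_mkord => /andP[lb ub]; split => //.
(* Only the shift from 1-based [T_lambda] to 0-based [nth] remains: [N - i.+1 + 1] has predecessor
   [N - i.+1]. *)
rewrite (le_trans _ lb) // le_eqVlt; apply/orP; left; apply/eqP.
by apply: eq_bigr => i _; rewrite /T_lambda addn1.
Qed.
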